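(* Let $p\ge2$, $n\ge 1$, let $x_1,\dots,x_n\in\mathbb R^p$ be fixed vectors, $\mathbb X=(x_1,\dots,x_n)^\top\in\mathbb R^{n\times p}$, and $Y_i=x_i^\top\beta^*+\xi_i$, $i=1,\dots,n$, with $\beta^*\in\mathbb R^p$. Let $\xi_i$ be i.i.d. Gaussian $\mathcal N(0,\sigma^2)$, $\sigma>0$, and let the diagonal elements of the matrix $\frac1n\mathbb X^\top\mathbb X$ be not larger than $1$. Take $\lambda=C\sigma\sqrt{\frac{\log p}{n}}$ with $C=3b\sqrt2$, $b\ge1$, and let $\hat\beta^\lambda$ be a Lasso estimator, i.e. a minimizer over $\beta\in\mathbb R^p$ of $\frac1n\sum_{i=1}^n(Y_i-x_i^\top\beta)^2+\lambda|\beta|_1$. Let $1\le s\le p$ be an integer and assume the Restricted Eigenvalue condition $\mathbf{RE}(s,5)$, i.e. $\kappa(s,5)>0$. Then, with probability at least $1-\frac1{p^{b^2-1}\sqrt{\pi\log p}}$, $$\frac1n|\mathbb X(\hat\beta^\lambda-\beta^* )|_2^2\le\inf_{\beta\in\mathbb R^p:\,M(\beta)\le s}\left\{\frac1n|\mathbb X(\beta-\beta^* )|_2^2+\frac{C^2\sigma^2}{\kappa^2(s,5)}\,\frac{M(\beta)\log p}{n}\right\}.$$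
   Context: $|\cdot|_q$ denotes the $\ell_q$-norm of vectors. $M(\beta)$ is the number of nonzero components of $\beta$. For $u\in\mathbb R^p$ and $J\subseteq\{1,\dots,p\}$, $u_J$ is the vector that coincides with $u$ on $J$ and is zero on the complement $J^c$. For an integer $1\le s\le p$ and $c_0>0$, $$\kappa(s,c_0)=\min_{J\subseteq\{1,\dots,p\},\,|J|\le s}\ \ \min_{u\in\mathbb R^p,\,u\ne0,\ |u_{J^c}|_1\le c_0|u_J|_1}\ \frac{|\mathbb Xu|_2}{\sqrt n\,|u_J|_2}$$ (nonempty $J$ only, since for $J=\emptyset$ no $u\neq 0$ is admissible). *)

(* Defs.v *)
From HB Require Import structures.
From mathcomp Require Import all_boot all_order all_algebra.
From mathcomp Require Import all_classical all_reals all_analysis.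

Set Implicit Arguments.
Unset Strict Implicit.
Unset Printing Implicit Defensive.

Import Order.TTheory GRing.Theory Num.Theory.

Local Open Scope classical_set_scope.
Local Open Scope ring_scope.

(* The canonical norm `|v| of a matrix is the sup norm, hence these. *)
Definition norm1 (R : realType) (m : nat) (v : 'cV[R]_m) : R :=
  \sum_(i < m) `|v i 0|.

Definition norm2 (R : realType) (m : nat) (v : 'cV[R]_m) : R :=
  Num.sqrt (\sum_(i < m) v i 0 ^+ 2).

(* The number of nonzero components, M(beta). *)
Definition nnz (R : realType) (m : nat) (v : 'cV[R]_m) : nat :=
  #|[pred i : 'I_m | v i 0 != 0]|.

(* u_J: kept in R^p, zero outside J. *)
Definition restrict_to (R : realType) (p : nat) (J : {set 'I_p})
    (u : 'cV[R]_p) : 'cV[R]_p :=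
  \col_j (if j \in J then u j 0 else 0).

(* The matrix (x_1, ..., x_n)^T. *)
Definition design (R : realType) (n p : nat) (x : 'I_n -> 'cV[R]_p) :
    'M[R]_(n, p) :=
  \matrix_(i, j) x i j 0.

Definition re_cone (R : realType) (p : nat) (J : {set 'I_p}) (c0 : R) :
    set 'cV[R]_p :=
  [set u | u != 0 /\
           norm1 (restrict_to (~: J)%SET u) <= c0 * norm1 (restrict_to J u)].

(* kappa(s, c0).  Both minima are written as infima in R.  They are attained:
   J ranges over a finite set, and for J nonempty the ratio is invariant under
   scaling of u, so that u may be restricted to the nonempty compact set of
   cone elements with |u_J|_2 = 1.  On the cone |u_J|_2 <> 0, so the division
   is genuine.  (For s = 0 the outer set is empty and inf gives 0; kappa is
   only meant for 1 <= s <= p.) *)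
Definition kappa (R : realType) (n p : nat) (X : 'M[R]_(n, p))
    (s : nat) (c0 : R) : R :=
  inf [set inf [set norm2 (X *m u) /
                    (Num.sqrt n%:R * norm2 (restrict_to J u))
               | u in re_cone J c0]
      | J in [set J : {set 'I_p} | J != finset.set0 /\ (#|J| <= s)%N]].

Definition RE (R : realType) (n p : nat) (X : 'M[R]_(n, p))
    (s : nat) (c0 : R) : Prop :=
  0 < kappa X s c0.

Definition lasso_objective (R : realType) (n p : nat)
    (x : 'I_n -> 'cV[R]_p) (y : 'I_n -> R) (lambda : R) (beta : 'cV[R]_p) : R :=
  n%:R^-1 * (\sum_(i < n) (y i - ((x i)^T *m beta) 0 0) ^+ 2)
  + lambda * norm1 beta.

Definition is_lasso (R : realType) (n p : nat)
    (x : 'I_n -> 'cV[R]_p) (y : 'I_n -> R) (lambda : R)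
    (betahat : 'cV[R]_p) : Prop :=
  forall beta : 'cV[R]_p,
    lasso_objective x y lambda betahat <= lasso_objective x y lambda beta.

(* Mutual independence: the product rule over every subfamily. *)
Definition mutually_independent (d : measure_display) (T : measurableType d)
    (R : realType) (P : probability T R) (I : finType)
    (X : I -> {RV P >-> R}) : Prop :=
  forall (J : {set I}) (A : I -> set R),
    (forall i, measurable (A i)) ->
    P (\bigcap_(i in [set i | i \in J]) (X i @^-1` A i))
    = (\prod_(i in J) P (X i @^-1` A i))%E.

(* A measure is a total function on sets, with no meaning on nonmeasurable
   ones; the first conjunct makes P E a genuine probability. *)
Definition with_probability_at_least (d : measure_display)
    (T : measurableType d) (R : realType) (P : probability T R)
    (a : R) (E : set T) : Prop :=
  measurable E /\ (a%:E <= P E)%E.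

(* Main.v *)
Require Import Defs.
From HB Require Import structures.
From mathcomp Require Import all_boot all_order all_algebra.
From mathcomp Require Import all_classical all_reals all_analysis.
From mathcomp Require Import measurable_realfun ring lra.

(** Write M_j = (1/n) sum_i x_ij xi_i.

    On the event max_j |M_j| <= lambda/3, compare the objective at the minimizer
    bh with its value at bh + t (beta - bh) and let t -> 0+: with u = bh - beta
    and J the support of beta,
      (2/n) <X (bh - beta^* ), X u> <= (5/3) lambda |u_J|_1
                                       - (1/3) lambda |u_{J^c}|_1.
    Either the left side is nonpositive, and polarization already gives the
    bound, or u lies in the cone with constant 5 and the restricted eigenvalue
    together with AM-GM absorbs |X u|^2.

    The same variational inequality shows that X bh depends 1-Lipschitz
    continuously on Y; hence the event is measurable although bh itself is an
    arbitrary choice of minimizers.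

    Each M_j is centered Gaussian with variance at most sigma^2/n (convolution
    of normal laws), so Mills' bound and a union bound over j control the
    probability that max_j |M_j| exceeds lambda/3 = b sigma sqrt(2 ln p / n). *)

Import Order.TTheory GRing.Theory Num.Theory.

Local Open Scope classical_set_scope.
Local Open Scope ring_scope.

(** * First-order optimality of a Lasso minimizer *)

(** For small [t] a negative linear term would outweigh the quadratic one. This stands in for a
    one-sided derivative at 0. *)
Lemma quadratic_ge0_slope (R : realFieldType) (A B : R) :
  (forall t, 0 < t -> t <= 1 -> 0 <= t * A + t ^+ 2 * B) -> 0 <= A.
Proof.
move=> H; rewrite leNgt; apply/negP => A0.
have nA : 0 < - A by rewrite oppr_gt0.
have D0 : 0 < `|B| + - A by rewrite ltr_wpDl.
(* This choice gives [t * |B| < - A / 2], hence [A + t * B < 0]. The summand [- A] keeps the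
   denominator positive even for [B = 0]. *)
pose t := - A / (2 * (`|B| + - A)).
have t0 : 0 < t by rewrite divr_gt0 // mulr_gt0.
have t1 : t <= 1.
  by rewrite ler_pdivrMr ?mulr_gt0 // mul1r; have := normr_ge0 B; lra.
have := H t t0 t1.
rewrite expr2 -mulrA -mulrDr pmulr_rge0 //.
have tD : t * (2 * (`|B| + - A)) = - A by rewrite /t divfK // gt_eqF ?mulr_gt0.
have : t * B <= t * `|B| by rewrite ler_wpM2l ?ler_norm // ltW.
have : 0 < t * - A by rewrite mulr_gt0.
by nra.
Qed.

Lemma designE (R : realType) (n p : nat) (x : 'I_n -> 'cV[R]_p) (u : 'cV[R]_p) i :
  ((x i)^T *m u) 0 0 = (design x *m u) i 0.
Proof. by rewrite !mxE; apply: eq_bigr => j _; rewrite !mxE. Qed.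

(** Along the segment from [bh] to [be] the squared loss is an exact quadratic in [t], and convexity
    keeps the penalty below its chord; minimality at [t = 0] makes the resulting slope
    nonnegative. *)
Lemma lasso_variational (R : realType) (n p : nat) (x : 'I_n -> 'cV[R]_p)
    (y : 'I_n -> R) (lambda : R) (bh be : 'cV[R]_p) :
  0 <= lambda -> is_lasso x y lambda bh ->
  0 <= n%:R^-1 * (2 * \sum_(i < n) ((design x *m bh) i 0 - y i) *
                    (design x *m (be - bh)) i 0)
       + lambda * (norm1 be - norm1 bh).
Proof.
move=> l0 lasso; set X := design x.
apply: (@quadratic_ge0_slope _ _
  (n%:R^-1 * \sum_(i < n) (X *m (be - bh)) i 0 ^+ 2)) => t t0 t1.
have := lasso (bh + t *: (be - bh)); rewrite /lasso_objective -subr_ge0.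
move/le_trans; apply.
have N1 : norm1 (bh + t *: (be - bh)) <= (1 - t) * norm1 bh + t * norm1 be.
  rewrite /norm1 !mulr_sumr -big_split /=; apply: ler_sum => j _.
  have -> : (bh + t *: (be - bh)) j 0 = (1 - t) * bh j 0 + t * be j 0.
    by rewrite !mxE; ring.
  apply: le_trans (ler_normD _ _) _; rewrite !normrM.
  by rewrite (ger0_norm (ltW t0)) ger0_norm // subr_ge0.
have -> : \sum_(i < n) (y i - ((x i)^T *m (bh + t *: (be - bh))) 0 0) ^+ 2 =
  \sum_(i < n) (y i - ((x i)^T *m bh) 0 0) ^+ 2
  + t * (2 * \sum_(i < n) ((X *m bh) i 0 - y i) * (X *m (be - bh)) i 0)
  + t ^+ 2 * \sum_(i < n) (X *m (be - bh)) i 0 ^+ 2.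
  rewrite !mulr_sumr -!big_split /=; apply: eq_bigr => i _.
  by rewrite !designE mulmxDr -scalemxAr !mxE; ring.
have := ler_wpM2l l0 N1.
by lra.
Qed.

(** * Restricted eigenvalue and the deterministic oracle inequality *)

(** A real infimum is a lower bound only when the set is bounded below; nonnegativity of the ratio
    secures this at both levels. *)
Lemma kappa_le (R : realType) (n p : nat) (X : 'M[R]_(n, p)) (s : nat) (c0 : R)
    (J : {set 'I_p}) (u : 'cV[R]_p) :
  J != finset.set0 -> (#|J| <= s)%N -> re_cone J c0 u ->
  kappa X s c0 <= norm2 (X *m u) / (Num.sqrt n%:R * norm2 (restrict_to J u)).
Proof.
move=> J0 Js uJ.
have ratio_ge0 (K : {set 'I_p}) v :
    0 <= norm2 (X *m v) / (Num.sqrt n%:R * norm2 (restrict_to K v)).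
  by rewrite divr_ge0 // ?mulr_ge0 // sqrtr_ge0.
pose inner (K : {set 'I_p}) := inf [set norm2 (X *m v) /
   (Num.sqrt n%:R * norm2 (restrict_to K v)) | v in re_cone K c0].
have inner_ge0 K : 0 <= inner K.
  (* The cone is empty for instance when [K] is; the infimum is then 0 by convention. *)
  rewrite /inner; have [->|/set0P ne] := eqVneq
    [set norm2 (X *m v) / (Num.sqrt n%:R * norm2 (restrict_to K v))
      | v in re_cone K c0] set0; first by rewrite inf0.
  by apply: lb_le_inf => // _ [v _ <-].
apply: (@le_trans _ _ (inner J)).
  apply: ge_inf; last by exists J.
  by exists 0 => _ [K _ <-]; exact: inner_ge0.
apply: ge_inf; last by exists u.
by exists 0 => _ [v _ <-].
Qed.

Lemma norm2_sq (R : realType) (m : nat) (v : 'cV[R]_m) :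
  norm2 v ^+ 2 = \sum_(i < m) v i 0 ^+ 2.
Proof. by rewrite sqr_sqrtr // sumr_ge0 // => i _; exact: sqr_ge0. Qed.

Lemma norm1_restrict (R : realType) (p : nat) (J : {set 'I_p}) (u : 'cV[R]_p) :
  norm1 (restrict_to J u) = \sum_(j in J) `|u j 0|.
Proof.
rewrite /norm1 [RHS]big_mkcond /=; apply: eq_bigr => j _.
by rewrite !mxE; case: ifP; rewrite ?normr0.
Qed.

Lemma norm2_restrict (R : realType) (p : nat) (J : {set 'I_p}) (u : 'cV[R]_p) :
  norm2 (restrict_to J u) ^+ 2 = \sum_(j in J) u j 0 ^+ 2.
Proof.
rewrite norm2_sq [RHS]big_mkcond /=; apply: eq_bigr => j _.
by rewrite !mxE; case: ifP; rewrite ?expr0n.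
Qed.

Lemma kappa_sq_le (R : realType) (n p : nat) (X : 'M[R]_(n, p)) (s : nat)
    (c0 : R) (J : {set 'I_p}) (u : 'cV[R]_p) : (0 < n)%N ->
  RE X s c0 -> J != finset.set0 -> (#|J| <= s)%N -> re_cone J c0 u ->
  kappa X s c0 ^+ 2 * \sum_(j in J) u j 0 ^+ 2
    <= n%:R^-1 * \sum_(i < n) (X *m u) i 0 ^+ 2.
Proof.
move=> n0 k0 J0 Js uJ; have := kappa_le _ _ _ X s c0 J u J0 Js uJ.
have sn0 : 0 < Num.sqrt n%:R :> R by rewrite sqrtr_gt0 ltr0n.
rewrite -norm2_restrict -norm2_sq.
(* The denominator can be cleared only if u_J is nonzero; otherwise the left side of the goal
   vanishes. *)
have [->|N0] := eqVneq (norm2 (restrict_to J u)) 0.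
  by move=> _; rewrite expr0n mulr0 mulr_ge0 // sqr_ge0.
have Np : 0 < norm2 (restrict_to J u) by rewrite lt0r N0 sqrtr_ge0.
rewrite ler_pdivlMr ?mulr_gt0 // => H.
rewrite [X in _ <= X]mulrC ler_pdivlMr ?ltr0n // -(sqr_sqrtr (ler0n R n)) -!exprMn.
rewrite ler_sqr ?nnegrE ?sqrtr_ge0 //; last first.
  by rewrite !mulr_ge0 // ltW.
by apply: le_trans H; rewrite le_eqVlt; apply/orP; left; apply/eqP; ring.
Qed.

(** This is the deterministic core, for any noise vector [e] below the threshold. The leading
    constant is 1 because the term [V] produced by polarization pays for the whole use of the
    restricted eigenvalue. *)
Lemma sharp_oracle (R : realType) (n p : nat) (x : 'I_n -> 'cV[R]_p)
    (betastar bh be : 'cV[R]_p) (y e : 'I_n -> R) (lambda : R) (s : nat) :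
  (0 < n)%N -> 0 <= lambda -> RE (design x) s 5 ->
  (forall i, y i = (design x *m betastar) i 0 + e i) ->
  (forall j, `|\sum_(i < n) n%:R^-1 * x i j 0 * e i| <= lambda / 3) ->
  is_lasso x y lambda bh -> (nnz be <= s)%N ->
  n%:R^-1 * norm2 (design x *m (bh - betastar)) ^+ 2 <=
  n%:R^-1 * norm2 (design x *m (be - betastar)) ^+ 2
    + lambda ^+ 2 / kappa (design x) s 5 ^+ 2 * (nnz be)%:R.
Proof.
move=> n0 l0 k0 yE noise lasso bes; set X := design x; set k := kappa _ _ _.
have := lasso_variational _ _ _ _ _ _ _ be l0 lasso; rewrite -/X => VI.
pose J : {set 'I_p} := finset (fun j => be j 0 != 0).
have cJ : #|J| = nnz be by rewrite /J cardsE.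
pose u := bh - be.
pose L := \sum_(j in J) `|u j 0|; pose K := \sum_(j in ~: J) `|u j 0|.
have Kc : K = \sum_(j | j \notin J) `|u j 0|.
  by apply: eq_bigl => j; rewrite inE.
have L0 : 0 <= L by apply: sumr_ge0.
have K0 : 0 <= K by apply: sumr_ge0.
pose D := n%:R^-1 * \sum_(i < n) (X *m (bh - betastar)) i 0 * (X *m u) i 0.
pose V := n%:R^-1 * \sum_(i < n) (X *m u) i 0 ^+ 2.
have V0 : 0 <= V.
  by rewrite mulr_ge0 // sumr_ge0 // => i _; exact: sqr_ge0.
(* Since [be - betastar = (bh - betastar) - u], the goal reduces to bounding [2 * D - V]. *)
have polar : n%:R^-1 * norm2 (X *m (be - betastar)) ^+ 2 =
    n%:R^-1 * norm2 (X *m (bh - betastar)) ^+ 2 - 2 * D + V.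
  rewrite /D /V !norm2_sq -[2 * _]mulrCA -mulrBr -mulrDr.
  rewrite [2 * _]mulr_sumr -sumrB -big_split /=.
  congr (_ * _); apply: eq_bigr => i _.
  by rewrite /u !mulmxBr !mxE; ring.
have noise_le : n%:R^-1 * \sum_(i < n) e i * (X *m u) i 0 <= lambda / 3 * (L + K).
  have -> : n%:R^-1 * \sum_(i < n) e i * (X *m u) i 0
     = \sum_(j < p) u j 0 * \sum_(i < n) n%:R^-1 * x i j 0 * e i.
    under [RHS]eq_bigr do rewrite mulr_sumr.
    rewrite exchange_big /= mulr_sumr; apply: eq_bigr => i _.
    rewrite mxE mulr_sumr mulr_sumr; apply: eq_bigr => j _.
    by rewrite !mxE; ring.
  have -> : L + K = \sum_j `|u j 0| by rewrite Kc (bigID (mem J) xpredT).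
  rewrite mulr_sumr; apply: ler_sum => j _.
  apply: le_trans (ler_norm _) _; rewrite normrM mulrC.
  by rewrite ler_wpM2r.
(* On [J] this is the triangle inequality; off [J] the entry of [be] is 0, so the difference is
   exactly minus the modulus of [u j 0]. *)
have norm1_le : norm1 be - norm1 bh <= L - K.
  rewrite /norm1 -sumrB (bigID (mem J)) /= Kc -sumrN.
  apply: lerD; apply: ler_sum => j jJ; rewrite /u !mxE.
    by rewrite distrC; exact: lerB_dist.
  move: jJ; rewrite inE negbK => /eqP ->.
  by rewrite normr0 subr0 sub0r.
(* The noise contributes [2 * lambda / 3 * (L + K)] and the penalty [lambda * (L - K)]. The ratio of
   the two resulting coefficients is the cone constant 5. *)
have main : 2 * D <= 5 / 3 * lambda * L - 3^-1 * lambda * K.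
  have : 0 <= - (2 * D) + 2 * (n%:R^-1 * \sum_(i < n) e i * (X *m u) i 0)
       + lambda * (norm1 be - norm1 bh).
    apply: le_trans VI _; rewrite lerD2r le_eqVlt; apply/orP; left; apply/eqP.
    rewrite /D ![2 * (n%:R^-1 * _)]mulrCA -mulrN -mulrDr; congr (_ * _).
    rewrite -mulrN -mulrDr; congr (2 * _).
    rewrite -sumrN -big_split /=; apply: eq_bigr => i _.
    by rewrite yE /u !mulmxBr !mxE; ring.
  have := ler_wpM2l l0 norm1_le.
  lra.
have C0 : 0 <= lambda ^+ 2 / k ^+ 2 * (nnz be)%:R.
  by rewrite mulr_ge0 // divr_ge0 // sqr_ge0.
(* When [D] is positive, [main] forces [K < 5 * L], which is the cone condition. *)
have [D0|D0] := leP D 0; first by rewrite polar; lra.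
have lp : 0 < lambda.
  rewrite lt0r l0 andbT; apply/eqP => z; move: main D0; rewrite z; lra.
have KL : K < 5 * L by rewrite -(ltr_pM2l lp); lra.
have Lp : 0 < L by lra.
have J0 : J != finset.set0.
  apply/eqP => JE; move: Lp; rewrite /L JE big_set0 ltxx //.
have uJ : re_cone J 5 u.
  split; last by rewrite !norm1_restrict; exact: ltW.
  apply/eqP => u0; move: Lp; rewrite /L big1 ?ltxx // => j _.
  by rewrite u0 mxE normr0.
have REu : k ^+ 2 * \sum_(j in J) u j 0 ^+ 2 <= V.
  by apply: kappa_sq_le => //; rewrite cJ.
have kp : 0 < k := k0.
(* AM-GM is applied coordinate by coordinate to [lambda / k] and [k * a], using 5/3 <= 2; summing
   over [J] produces the factor [#|J|]. *)
have amgm : 5 / 3 * lambda * L <= lambda ^+ 2 / k ^+ 2 * (nnz be)%:R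
    + k ^+ 2 * \sum_(j in J) u j 0 ^+ 2.
  rewrite -cJ -sumr_const /L !mulr_sumr -big_split /=.
  under [X in _ <= X]eq_bigr do rewrite mulr1.
  apply: ler_sum => j _; rewrite -[u j 0 ^+ 2]real_normK ?num_real //.
  set a := `|u j 0|; rewrite -expr_div_n -exprMn.
  rewrite (_ : 5 / 3 * lambda * a = 5 / 3 * ((lambda / k) * (k * a))).
    have : 0 <= (lambda / k) * (k * a).
      by have kge0 := ltW kp; rewrite !mulr_ge0 ?invr_ge0 // /a.
    by have := sqr_ge0 (lambda / k - k * a); nra.
  by rewrite [lambda / k * _]mulrA divfK ?gt_eqF // mulrA.
have LK : 0 <= 3^-1 * lambda * K by rewrite !mulr_ge0.
rewrite polar; lra.
Qed.

(** * Measurability of the fitted values *)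

(** Continuity is expressed on [T] through the [Y i], since [g] is not given as a function of them.
    Each set where [g] exceeds [c] is a union of preimages of rational boxes, and there are
    countably many such boxes. *)
Lemma measurable_fun_continuous_factor (d : measure_display)
    (T : measurableType d) (R : realType) (I : finType) (Y : I -> T -> R)
    (g : T -> R) :
  (forall i, measurable_fun setT (Y i)) ->
  (forall (w : T) (e : R), 0 < e -> exists2 delta : R, 0 < delta &
     forall w', (forall i, `|Y i w - Y i w'| < delta) -> `|g w - g w'| < e) ->
  measurable_fun setT g.
Proof.
move=> mY gY.
apply: (measurability _ (RGenOInfty.measurableE R)) => // _ [_ [c ->] <-].
rewrite setTI.
pose box (q : {ffun I -> rat} * rat) : set T :=
  \big[setI/setT]_(i : I) 
    (Y i @^-1` `](ratr (q.1 i) - ratr q.2 : R), (ratr (q.1 i) + ratr q.2)[).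
have boxP q w : box q w <-> forall i, `|Y i w - ratr (q.1 i)| < ratr q.2.
  rewrite /box; split => [+ i|H].
    by rewrite (bigD1 i) //= => -[]; rewrite in_itv /= ltr_distl.
  elim/big_ind : _ => // i _; rewrite /= in_itv /=.
  by rewrite -ltr_distl; exact: H.
(* Boxes that leave the superlevel set are replaced by the empty set, so the union runs over all
   rational data. *)
pose U q := if `[< box q `<=` g @^-1` `]c, +oo[ >] then box q else set0.
rewrite (_ : _ @^-1` _ = \bigcup_q U q).
  apply: countable_bigcupT_measurable => // q; rewrite /U; case: ifP => // _.
  apply: bigsetI_measurable => i _; rewrite -[X in measurable X]setTI.
  by apply: mY => //; exact: measurable_itv.
apply/seteqP; split => [w /=|w [q _]]; last first.
  by rewrite /U; case: ifP => // /asboolP; exact.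
rewrite in_itv /= andbT -subr_gt0 => gw; have [delta d0 near_w] := gY w _ gw.
(* Two points of a box of radius [r] differ by less than [2 * r] in each coordinate, hence the bound
   [delta / 2]. *)
have [r] : exists r : rat, ratr r \in `]0 : R, delta / 2[.
  by apply: rat_in_itvoo; rewrite divr_gt0.
rewrite in_itv /= => /andP[r0 rd].
have /choice[q qP] : forall i : I, exists q : rat, `|Y i w - ratr q| < ratr r :> R.
  move=> i; have [|q] := @rat_in_itvoo R (Y i w - ratr r) (Y i w + ratr r); first by lra.
  by rewrite in_itv /= => ?; exists q; rewrite distrC ltr_distl.
pose qr := ([ffun i => q i], r).
have wq : box qr w by apply/boxP => i; rewrite ffunE.
exists qr => //; rewrite /U; case: ifP => // /negP[]; apply/asboolP => w' /boxP w'q.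
rewrite /= in_itv /= andbT.
have : `|g w - g w'| < g w - c.
  apply: near_w => i; have := w'q i; rewrite ffunE /= => ?.
  have := ler_distD (ratr (q i)) (Y i w) (Y i w').
  by rewrite (distrC (ratr _)); have := qP i; lra.
by rewrite ltr_norml => /andP[_]; lra.
Qed.

(** Each minimizer is tested against the other; in the sum of the two variational inequalities the
    penalties cancel, and AM-GM finishes. For [y = y'] it shows that the fit does not depend on the
    chosen minimizer. *)
Lemma lasso_fit_lipschitz (R : realType) (n p : nat) (x : 'I_n -> 'cV[R]_p)
    (y y' : 'I_n -> R) (lambda : R) (bh bh' : 'cV[R]_p) :
  (0 < n)%N -> 0 <= lambda ->
  is_lasso x y lambda bh -> is_lasso x y' lambda bh' ->
  \sum_(i < n) ((design x *m bh) i 0 - (design x *m bh') i 0) ^+ 2 <=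
  \sum_(i < n) (y i - y' i) ^+ 2.
Proof.
move=> n0 l0 lb lb'; set X := design x.
have := lasso_variational _ _ _ _ _ _ _ bh' l0 lb.
have := lasso_variational _ _ _ _ _ _ _ bh l0 lb'.
rewrite -/X => H H'; have := addr_ge0 H H'.
rewrite [X in _ <= X -> _](_ : _ = 2 * n%:R^-1 * \sum_(i < n)
    ((y i - y' i) * ((X *m bh) i 0 - (X *m bh') i 0)
     - ((X *m bh) i 0 - (X *m bh') i 0) ^+ 2)); last first.
  rewrite addrACA -mulrDr -[RHS]addr0; congr (_ + _); last by ring.
  rewrite -mulrDr mulrA [n%:R^-1 * _]mulrC;
  congr (_ * _); rewrite -big_split; apply: eq_bigr => i _.
  by rewrite !mulmxBr !mxE /=; ring.
rewrite pmulr_rge0 ?mulr_gt0 ?invr_gt0 ?ltr0n // sumrB subr_ge0 => {}H.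
suff : 2 * \sum_(i < n) (y i - y' i) * ((X *m bh) i 0 - (X *m bh') i 0)
    <= \sum_(i < n) (y i - y' i) ^+ 2
       + \sum_(i < n) ((X *m bh) i 0 - (X *m bh') i 0) ^+ 2 by lra.
rewrite mulr_sumr -big_split /=; apply: ler_sum => i _.
by have := sqr_ge0 ((y i - y' i) - ((X *m bh) i 0 - (X *m bh') i 0)); nra.
Qed.

Lemma measurable_lasso_fit (R : realType) (d : measure_display)
    (T : measurableType d) (n p : nat) (x : 'I_n -> 'cV[R]_p)
    (Y : 'I_n -> T -> R) (lambda : R) (bh : T -> 'cV[R]_p) (i : 'I_n) :
  (0 < n)%N -> 0 <= lambda -> (forall i, measurable_fun setT (Y i)) ->
  (forall w, is_lasso x (fun i => Y i w) lambda (bh w)) ->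
  measurable_fun setT (fun w => (design x *m bh w) i 0).
Proof.
move=> n0 l0 mY lasso; apply: (measurable_fun_continuous_factor _ _ _ _ _ _ mY) => w e e0.
have n0R : 0 < n%:R :> R by rewrite ltr0n.
(* The sum of [n] squares below [(e / n) ^ 2] is below [e ^ 2 / n], which is at most [e ^ 2]. *)
exists (e / n%:R) => [|w' near_w]; first by rewrite divr_gt0.
have : ((design x *m bh w) i 0 - (design x *m bh w') i 0) ^+ 2 < e ^+ 2.
  have := lasso_fit_lipschitz _ _ _ _ _ _ _ _ _ n0 l0 (lasso w) (lasso w').
  rewrite [in X in X -> _](bigD1 i) //= => H.
  apply: (@le_lt_trans _ _ (\sum_(j < n) (Y j w - Y j w') ^+ 2)).
    apply: le_trans H; rewrite lerDl; apply: sumr_ge0 => j _; exact: sqr_ge0.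
  apply: (@lt_le_trans _ _ (\sum_(j < n) (e / n%:R) ^+ 2)).
    apply: ltr_sum; first by apply/hasP; exists i => //; exact: mem_index_enum.
    move=> j _; rewrite -real_normK ?num_real // ltr_sqr ?nnegrE //.
    by rewrite divr_ge0 // ltW.
  rewrite sumr_const card_ord -[_ ^+ 2 *+ _]mulr_natl expr_div_n mulrCA.
  rewrite ler_piMr ?sqr_ge0 //.
  by rewrite expr2 invfM mulrA divff ?gt_eqF // mul1r invf_le1 // ler1n.
by rewrite -[_ ^+ 2]real_normK ?num_real // ltr_sqr ?nnegrE // ltW.
Qed.

(** * Convolution of centered normal laws *)

Section normal_law.
Context {R : realType}.
Local Notation mu := (@lebesgue_measure R).

Lemma lebesgue_measure_shift (c : R) (A : set R) : measurable A ->
  pushforward mu (fun x : measurableTypeR R => x + c : measurableTypeR R) A = mu A.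
Proof.
move=> mA; have mc : measurable_fun setT
    (fun x : measurableTypeR R => x + c : measurableTypeR R).
  exact: measurable_funD.
apply/esym; apply: lebesgue_measure_unique => // _ [[a b] _ <-].
rewrite /= /pushforward.
rewrite (_ : _ @^-1` _ = `]a - c, b - c]%classic); last first.
  by apply/seteqP; split => x /=; rewrite !in_itv /= ltrBlDr lerBrDr.
rewrite !lebesgue_measure_itv /= !lte_fin ltrD2r.
by case: ifP => // _; rewrite -!EFinB; congr (_%:E); ring.
Qed.

Lemma ge0_integral_shift (c : R) (f : R -> \bar R) :
  measurable_fun setT f -> (forall x, (0 <= f x)%E) ->
  (\int[mu]_x f (x + c)%R = \int[mu]_x f x)%E.
Proof.
move=> mf f0.
have mc : measurable_fun setT (fun x : measurableTypeR R => x + c : measurableTypeR R).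
  exact: measurable_funD.
transitivity (\int[pushforward mu
  (fun x : measurableTypeR R => (x + c)%R : measurableTypeR R)]_x f x)%E.
  by rewrite ge0_integral_pushforward.
by apply: eq_measure_integral => A mA _; exact: lebesgue_measure_shift.
Qed.

(** The Radon-Nikodym derivative and the density have the same integral over every measurable set,
    so they agree almost everywhere. *)
Lemma integral_normal_prob (m s : R) (f : R -> \bar R) :
  measurable_fun setT f ->
  (\int[normal_prob m s]_x `|f x| < +oo)%E ->
  (\int[normal_prob m s]_x f x = \int[mu]_x (f x * (normal_pdf m s x)%:E))%E.
Proof.
move=> mf finf.
rewrite -(Radon_Nikodym_change_of_variables (normal_prob_dominates m s))//=; last first.
  by apply/integrableP; split.
apply: ae_eq_integral => //.
- apply: emeasurable_funM => //; apply: (measurable_int mu).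
  by apply: Radon_Nikodym_integrable; exact: normal_prob_dominates.
- by apply: emeasurable_funM => //=; apply/measurableT_comp => //=;
    exact: measurable_normal_pdf.
- apply: ae_eqe_mul2l => /=.
  apply: integral_ae_eq => //=.
  + by apply: Radon_Nikodym_integrable; exact: normal_prob_dominates.
  + by apply/measurableT_comp => //=; exact: measurable_normal_pdf.
  + move=> E _ mE; rewrite -Radon_Nikodym_integral //=.
    exact: normal_prob_dominates.
Qed.

(** Completing the square in [y]: the joint density of [y] and [z] splits into the marginal density
    of [z] and the conditional density of [y] given [z]. *)
Lemma normal_pdf_mul (s t a y z : R) : s != 0 -> t != 0 ->
  let r := Num.sqrt (s ^+ 2 + a ^+ 2 * t ^+ 2) in
  normal_pdf 0 s (z - a * y) * normal_pdf 0 t y =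
  normal_pdf 0 r z * normal_pdf (a * t ^+ 2 * z / r ^+ 2) (s * t / r) y.
Proof.
move=> s0 t0 r.
have s2 : 0 < s ^+ 2 by rewrite exprn_even_gt0.
have t2 : 0 < t ^+ 2 by rewrite exprn_even_gt0.
have at0 : 0 <= a ^+ 2 * t ^+ 2 by rewrite mulr_ge0 // sqr_ge0.
have rr : r ^+ 2 = s ^+ 2 + a ^+ 2 * t ^+ 2.
  by rewrite sqr_sqrtr // addr_ge0 // ltW.
have r2 : 0 < r ^+ 2.
  by rewrite rr ltr_pwDl.
have r0 : r != 0 by rewrite -sqrf_eq0 gt_eqF.
have q0 : s * t / r != 0 by rewrite !mulf_neq0 ?invr_eq0.
rewrite !normal_pdfE // mulrACA [RHS]mulrACA /normal_fun -!expRD; congr (_ * _).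
  have pk0 (v : R) : 0 <= v ^+ 2 * pi *+ 2.
    by rewrite mulrn_wge0 // mulr_ge0 ?pi_ge0 // sqr_ge0.
  rewrite /normal_peak -!invfM -!sqrtrM ?pk0 //.
  congr (Num.sqrt _)^-1.
  rewrite exprMn exprVn exprMn.
  by field.
congr expR; rewrite expr_div_n exprMn subr0.
move: (gt_eqF r2) => /negbT r2n.
rewrite !mulr2n; rewrite rr in r2n *; field.
have rp : 0 < s ^+ 2 + a ^+ 2 * t ^+ 2 by rewrite -rr.
have st2 : 0 < s ^+ 2 * t ^+ 2 by exact: mulr_gt0.
by rewrite !exprMn !gt_eqF // addr_gt0.
Qed.

Lemma normal_prob_shift (s c : R) (B : set R) : measurable B ->
  normal_prob 0 s [set x | B (x + c)] =
  (\int[mu]_z (\1_B z * normal_pdf 0 s (z - c))%:E)%E.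
Proof.
move=> mB; rewrite /normal_prob integral_mkcond.
rewrite -[RHS](ge0_integral_shift c) => [||x]; first last.
- by rewrite lee_fin mulr_ge0 // normal_pdf_ge0.
- apply/measurable_EFinP/measurable_funM => //=.
  apply: measurableT_comp; first exact: measurable_normal_pdf.
  exact: measurable_funB.
apply: eq_integral => x _.
rewrite patchE indicE addrK.
have -> : (x \in [set x | B (x + c)]) = (x + c \in B).
  by apply/idP/idP; rewrite !inE.
by case: (_ \in _); rewrite ?mul1r ?mul0r.
Qed.

(** Tonelli's theorem moves the integral in [y] inside, where by [normal_pdf_mul] only a conditional
    density of total mass 1 depends on [y]. *)
Lemma normal_prob_convolution (s t a : R) (B : set R) :
  s != 0 -> t != 0 -> measurable B ->
  (normal_prob 0 t \x normal_prob 0 s)%E [set u | B (u.2 + a * u.1)] =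
  normal_prob 0 (Num.sqrt (s ^+ 2 + a ^+ 2 * t ^+ 2)) B.
Proof.
move=> s0 t0 mB; set r := Num.sqrt _.
set A := [set u | _].
have mA : measurable A.
  rewrite -[A]setTI; apply: (_ : measurable_fun setT
    (fun u : measurableTypeR R * measurableTypeR R => u.2 + a * u.1)) => //.
  apply: measurable_funD; first exact: measurable_snd.
  by apply: measurable_funM => //; exact: measurable_fst.
have mf := measurable_fun_xsection (normal_prob 0 s) mA.
rewrite /product_measure1 /= integral_normal_prob //; last first.
  (* Integrability: every section has probability at most 1. *)
  apply: (@le_lt_trans _ _ (\int[normal_prob 0 t]_x (cst 1 x))%E).
    apply: ge0_le_integral => //=; first exact: measurableT_comp.
    move=> x _; rewrite gee0_abs ?measure_ge0 //.
    by apply: probability_le1; exact: measurable_xsection.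
  rewrite integral_cst // mul1e; apply: le_lt_trans (ltry 1).
  exact: (probability_le1 (normal_prob 0 t) measurableT).
pose F (u : measurableTypeR R * measurableTypeR R) : \bar R :=
  (\1_B u.2 * normal_pdf 0 s (u.2 - a * u.1) * normal_pdf 0 t u.1)%:E.
have mF : measurable_fun setT F.
  apply/measurable_EFinP; apply: measurable_funM; last first.
    by apply: measurableT_comp => //; exact: measurable_normal_pdf.
  apply: measurable_funM.
    by apply: measurableT_comp => //; exact: measurable_indic.
  apply: measurableT_comp; first exact: measurable_normal_pdf.
  apply: measurable_funB; first exact: measurable_snd.
  by apply: measurable_funM => //; exact: measurable_fst.
have F0 u : (0 <= F u)%E.
  by rewrite lee_fin !mulr_ge0 ?normal_pdf_ge0.
transitivity (\int[mu]_y \int[mu]_z F (y, z))%E.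
  apply: eq_integral => y _.
  have -> : xsection A y = [set x | B (x + a * y)].
    by rewrite /xsection; apply/seteqP; split=> x /=; rewrite inE.
  rewrite normal_prob_shift // -ge0_integralZr //=.
  - apply/measurable_EFinP; apply: measurable_funM; first exact: measurable_indic.
    apply: measurableT_comp; first exact: measurable_normal_pdf.
    exact: measurable_funB.
  - by move=> x _; rewrite lee_fin mulr_ge0 ?normal_pdf_ge0.
  - by rewrite lee_fin normal_pdf_ge0.
rewrite fubini_tonelli // /normal_prob [RHS]integral_mkcond.
apply: eq_integral => z _.
transitivity (\int[mu]_y ((\1_B z * normal_pdf 0 r z)%:E *
   (normal_pdf (a * t ^+ 2 * z / r ^+ 2) (s * t / r) y)%:E))%E.
  apply: eq_integral => y _; rewrite /F /= -EFinM.
  by rewrite -mulrA normal_pdf_mul // mulrA.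
rewrite ge0_integralZl //=; first last.
- by rewrite lee_fin mulr_ge0 ?normal_pdf_ge0.
- by move=> x _; rewrite lee_fin normal_pdf_ge0.
- by apply/measurable_EFinP; exact: measurable_normal_pdf.
rewrite integral_normal_pdf mule1 patchE indicE.
by case: (_ \in _); rewrite ?mul1r ?mul0r.
Qed.

End normal_law.

(** * Linear combinations of independent normal variables *)

Section normal_sums.
Context {R : realType} {d : measure_display} {T : measurableType d}.
Context {P : probability T R} {I : finType}.
Variable xi : I -> {RV P >-> R}.
Hypothesis xi_indep : mutually_independent xi.

Let inter (K : {set I}) (A : I -> set R) : set T :=
  \bigcap_(i in [set i | i \in K]) (xi i @^-1` A i).

Let measurable_inter K A : (forall i, measurable (A i)) -> measurable (inter K A).
Proof.
move=> mA; apply: fin_bigcap_measurable; first exact: finite_finset.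
by move=> i _; rewrite -[X in measurable X]setTI; exact: measurable_funP.
Qed.

Let inter_setU1 (j : I) (K : {set I}) (A : I -> set R) (B : set R) : j \notin K ->
  inter (j |: K)%SET (fun i => if i == j then B else A i) =
  (xi j @^-1` B) `&` inter K A.
Proof.
move=> jK; apply/seteqP; split => [w H|w [Hj HK] i /=].
  split; first by have := H j; rewrite /= eqxx; apply; rewrite !inE eqxx.
  move=> i /= iK; have := H i; rewrite /= ifN; first by apply; rewrite !inE iK orbT.
  by apply: contraNneq jK => <-.
by rewrite !inE; case: eqVneq => [->|] //= _ iK; exact: HK.
Qed.

Let measurable_if (j : I) (A : I -> set R) (B : set R) : (forall i, measurable (A i)) ->
  measurable B -> forall i, measurable (if i == j then B else A i).
Proof. by move=> mA mB i; case: ifP. Qed.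

Let prob_inter_setU1 (j : I) (K : {set I}) (A : I -> set R) (B : set R) :
  j \notin K -> (forall i, measurable (A i)) ->
  measurable B ->
  P ((xi j @^-1` B) `&` inter K A) = (P (xi j @^-1` B) * P (inter K A))%E.
Proof.
move=> jK mA mB; rewrite -inter_setU1 // /inter !xi_indep //; last first.
  exact: measurable_if.
rewrite big_setU1 //= eqxx; congr (_ * _)%E; apply: eq_bigr => i iK.
by rewrite ifN //; apply: contraNneq jK => <-.
Qed.

Variable sigma : R.
Hypothesis sigma_gt0 : 0 < sigma.
Hypothesis xi_normal : forall i (A : set R), measurable A ->
  distribution P (xi i) A = normal_prob 0 sigma A.

Let lincomb (c : I -> R) (J : {set I}) w := \sum_(i in J) c i * xi i w.

Let measurable_lincomb c J : measurable_fun setT (lincomb c J).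
Proof.
rewrite (_ : lincomb c J = fun w => \sum_i (if i \in J then c i * xi i w else 0)).
  by apply: measurable_sum => i; case: (i \in J) => //; exact: measurable_funM.
by apply/funext => w; rewrite /lincomb big_mkcond.
Qed.

(* The additional events on the coordinates outside [J] carry the independence
   of the partial sum from the remaining variables through the induction. *)
Let lincomb_normal_indep (c : I -> R) (i0 : I) : c i0 = 1 ->
  forall k (J K : {set I}) (A : I -> set R) (B : set R),
  #|J| = k.+1 -> i0 \in J -> (forall i, i \in J -> i \notin K) ->
  (forall i, measurable (A i)) -> measurable B ->
  P ((lincomb c J @^-1` B) `&` inter K A) =
  (normal_prob 0 (sigma * Num.sqrt (\sum_(i in J) c i ^+ 2))
     B * P (inter K A))%E.
Proof.
move=> c1; elim=> [|k IH] J K A B cardJ i0J JK mA mB.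
  have JE : J = [set i0]%SET.
    by apply/esym/eqP; rewrite eqEcard finset.sub1set i0J cardJ cards1.
  have i0K : i0 \notin K by apply: JK.
  rewrite {}JE big_set1 c1 expr1n sqrtr1 mulr1 -(xi_normal i0) //.
  rewrite -prob_inter_setU1 //; congr (P (_ `&` _)).
  by apply/funext => w; rewrite /= /lincomb big_set1 c1 mul1r.
have [j jJ ji0] : exists2 j, j \in J & j != i0.
  have : (0 < #|(J :\ i0)%SET|)%N 
    by have := cardsD1 i0 J; rewrite i0J cardJ add1n => -[<-].
  by move/card_gt0P => [j]; rewrite !inE => /andP[ji0 jJ]; exists j.
pose J' := (J :\ j)%SET.
have i0J' : i0 \in J' by rewrite !inE eq_sym ji0.
have jK : j \notin K by apply: JK.
have cardJ' : #|J'| = k.+1.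
  by move: cardJ; rewrite (cardsD1 j J) jJ => -[].
have J'K i : i \in J' -> i \notin K by rewrite inE => /andP[_ /JK].
have J'jK i : i \in J' -> i \notin (j |: K)%SET.
  by move=> iJ'; rewrite !inE negb_or (J'K i iJ') andbT;
    move: iJ'; rewrite !inE => /andP[].
pose E := inter K A.
have mE : measurable E by exact: measurable_inter.
pose tau := sigma * Num.sqrt (\sum_(i in J') c i ^+ 2).
have sum_gt0 : 0 < \sum_(i in J') c i ^+ 2.
  rewrite (bigD1 i0) //= c1 expr1n ltr_pwDl // sumr_ge0 // => i _.
  exact: sqr_ge0.
have tau0 : tau != 0 by rewrite gt_eqF // mulr_gt0 // sqrtr_gt0.
pose f (w : T) : measurableTypeR R * measurableTypeR R := (xi j w, lincomb c J' w).
have mf : measurable_fun setT f.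
  apply: measurable_fun_pair; first exact: (measurable_funP (xi j)).
  exact: measurable_lincomb.
have pE0 : 0 <= fine (P E) by rewrite fine_ge0.
have pEE : (fine (P E))%:E = P E by rewrite fineK // fin_num_measure.
pose m2 := mscale (NngNum pE0) (normal_prob 0 tau).
pose m' := pushforward (mrestr P mE) f.
pose D := [set u : measurableTypeR R * measurableTypeR R | B (u.2 + c j * u.1)].
have mD : measurable D.
  rewrite -[D]setTI; apply: (_ : measurable_fun setT
    (fun u : measurableTypeR R * measurableTypeR R => u.2 + c j * u.1)) => //.
  apply: measurable_funD; first exact: measurable_snd.
  by apply: measurable_funM => //; exact: measurable_fst.
have prodE : forall X, measurable X -> (normal_prob 0 sigma \x m2)%E X = m' X.
  apply: product_measure_unique => // A1 A2 mA1 mA2.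
  rewrite /m2 /= /mscale /= pEE.
  have -> : pushforward (mrestr P mE) f (A1 `*` A2) =
      P ((lincomb c J' @^-1` A2) `&`
         inter (j |: K)%SET (fun i => if i == j then A1 else A i)).
    rewrite inter_setU1 // /pushforward /mrestr; congr (P _).
    by apply/seteqP; split => w /= [] => [[]|? []].
  rewrite IH //; last exact: measurable_if.
  rewrite inter_setU1 // prob_inter_setU1 //.
  have -> : P (xi j @^-1` A1) = normal_prob 0 sigma A1 by exact: xi_normal.
  by rewrite muleCA -/E [(P E * _)%E]muleC.
transitivity (m' D).
  rewrite /m' /pushforward /mrestr; congr (P (_ `&` _)).
  apply/seteqP; split => w; rewrite /= /lincomb (big_setD1 j) //= addrC //.
rewrite -prodE //.
transitivity (P E * (normal_prob 0 sigma \x normal_prob 0 tau)%E D)%E.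
  rewrite /product_measure1 /m2 /= /mscale /= -pEE ge0_integralZl //=.
  by apply: measurable_fun_xsection.
rewrite normal_prob_convolution ?(gt_eqF sigma_gt0) // muleC;
  congr (normal_prob 0 _ B * _)%E.
rewrite (big_setD1 j) //= -/J' exprMn sqr_sqrtr ?ltW //.
rewrite [sigma ^+ 2 * _]mulrC -mulrDl sqrtrM; last first.
  by rewrite addr_ge0 ?sqr_ge0 // ltW.
by rewrite sqrtr_sqr gtr0_norm // mulrC addrC.
Qed.

Lemma lincomb_normal (c : I -> R) (i0 : I) (B : set R) : c i0 = 1 ->
  measurable B ->
  P [set w | B (\sum_i c i * xi i w)] =
  normal_prob 0 (sigma * Num.sqrt (\sum_i c i ^+ 2)) B.
Proof.
move=> c1 mB.
have := @lincomb_normal_indep c i0 c1 #|I|.-1 [set: I]%SET finset.set0 (fun=> setT) B.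
have -> : inter finset.set0 (fun=> setT) = setT.
  by apply/seteqP; split => // w _ i /=; rewrite inE.
rewrite setIT probability_setT mule1.
have sumT (F : I -> R) : \sum_(i in [set: I]%SET) F i = \sum_i F i.
  by apply: eq_bigl => i; rewrite inE.
rewrite sumT.
have -> : lincomb c [set: I]%SET @^-1` B = [set w | B (\sum_i c i * xi i w)].
  by apply/funext => w; rewrite /= /lincomb sumT.
apply => //.
- by rewrite cardsT prednK //; apply/card_gt0P; exists i0.
- by move=> i _; rewrite inE.
Qed.

End normal_sums.

Section gaussian_tail.
Import numFieldNormedType.Exports.
Context {R : realType}.
Local Notation mu := (@lebesgue_measure R).

Lemma gauss_fun_tail (k u : R) : 0 < k -> 0 < u ->
  (\int[mu]_(x in `[u, +oo[) (gauss_fun (k * x))%:E <=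
   ((2 * k ^+ 2 * u)^-1 * gauss_fun (k * u))%:E)%E.
Proof.
move=> k0 u0.
have c0 : 0 < 2 * k ^+ 2 * u by rewrite !mulr_gt0.
pose f x := 2 * k ^+ 2 * x * gauss_fun (k * x).
pose F x := - gauss_fun (k * x).
have dF (x : R) : is_derive x 1 F (f x).
  rewrite /F /gauss_fun; apply: is_derive_eq.
  by rewrite /f /gauss_fun /GRing.scale /=; ring.
have cf : continuous f.
  move=> x; apply: cvgM.
    by apply: cvgM; [exact: cvg_cst|exact: cvg_id].
  apply: (cvg_comp (fun y => k * y) (@gauss_fun R)).
    by apply: cvgM; [exact: cvg_cst|exact: cvg_id].
  exact: continuous_gauss_fun.
have int_f : (\int[mu]_(x in `[u, +oo[) (f x)%:E = (gauss_fun (k * u))%:E)%E.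
  rewrite (@ge0_continuous_FTC2y _ f F u 0).
  - by rewrite /F -EFinB sub0r opprK.
  - move=> x ux; rewrite /f mulr_ge0 ?gauss_fun_ge0 // mulr_ge0 //.
      by rewrite mulr_ge0 // ltW // exprn_gt0.
    by rewrite (le_trans _ ux) // ltW.
  - exact: continuous_subspaceT.
  - rewrite -oppr0 /F; apply: cvgN.
    apply: (cvg_comp (fun y => k * y) (@gauss_fun R)); last exact: cvg_gauss_fun.
    by apply/gt0_cvgMry => //; exact: cvg_id.
  - by move=> x _; have [] := dF x.
  - apply: cvg_at_right_filter.
    have : differentiable F u by apply/derivable1_diffP; have [] := dF u.
    exact: differentiable_continuous.
  - by move=> x _; rewrite derive1E; have [_ ->] := dF x.
have -> : (((2 * k ^+ 2 * u)^-1 * gauss_fun (k * u))%:E =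
    (2 * k ^+ 2 * u)^-1%:E * \int[mu]_(x in `[u, +oo[) (f x)%:E)%E.
  by rewrite int_f EFinM.
have mg : measurable_fun setT (fun x => gauss_fun (k * x)).
  by apply: measurableT_comp; [exact: measurable_gauss_fun|exact: measurable_funM].
have mf : measurable_fun setT f.
  by apply: measurable_funM => //; exact: measurable_funM.
have f0 x : u <= x -> 0 <= f x.
  move=> ux; rewrite /f mulr_ge0 ?gauss_fun_ge0 // mulr_ge0 //.
    by rewrite mulr_ge0 // ltW // exprn_gt0.
  by rewrite (le_trans _ ux) // ltW.
rewrite -ge0_integralZl //=; last 3 first.
- by apply/measurable_EFinP; exact: measurable_funTS.
- by move=> x; rewrite in_itv /= andbT lee_fin => /f0.
- by rewrite lee_fin invr_ge0 ltW.
apply: ge0_le_integral => //=.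
- by move=> x _; rewrite lee_fin gauss_fun_ge0.
- by apply/measurable_EFinP; exact: measurable_funTS.
- by apply/measurable_EFinP/measurable_funM => //; exact: measurable_funTS.
- move=> x; rewrite in_itv /= andbT => ux; rewrite lee_fin /f mulrA.
  rewrite ler_peMl ?gauss_fun_ge0 // mulrC ler_pdivlMr // mul1r.
  by rewrite ler_pM2l // mulr_gt0 // exprn_gt0.
Qed.

Lemma normal_prob_tail (s z : R) : 0 < s -> 0 < z ->
  (normal_prob 0 s [set x : R | (z * s < `|x|)%R] <=
   (2 * ((z * Num.sqrt (2 * pi))^-1 * expR (- (z ^+ 2 / 2))))%:E)%E.
Proof.
move=> s0 z0; pose u := z * s.
have u0 : 0 < u by rewrite mulr_gt0.
pose k := (s * Num.sqrt 2)^-1.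
have k0 : 0 < k by rewrite invr_gt0 mulr_gt0 // sqrtr_gt0.
have k2 : k ^+ 2 = (s ^+ 2 * 2)^-1 by rewrite exprVn exprMn sqr_sqrtr.
have pdfE x : normal_pdf 0 s x = normal_peak s * gauss_fun (k * x).
  rewrite normal_pdfE ?gt_eqF // /normal_fun /gauss_fun subr0.
  by congr (_ * expR _); rewrite exprMn k2 mulNr mulrC mulr_natr.
have half : (normal_prob 0 s `[u, +oo[ <=
    ((z * Num.sqrt (2 * pi))^-1 * expR (- (z ^+ 2 / 2)))%:E)%E.
  rewrite /normal_prob; under eq_integral do rewrite pdfE EFinM.
  rewrite ge0_integralZl //=; last 3 first.
  - apply/measurable_EFinP/measurable_funTS.
    by apply: measurableT_comp; [exact: measurable_gauss_fun|exact: measurable_funM].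
  - by move=> x _; rewrite lee_fin gauss_fun_ge0.
  - by rewrite lee_fin normal_peak_ge0.
  apply: (@le_trans _ _ ((normal_peak s)%:E *
      ((2 * k ^+ 2 * u)^-1 * gauss_fun (k * u))%:E)%E).
    by apply: lee_wpmul2l; [rewrite lee_fin normal_peak_ge0|exact: gauss_fun_tail].
  rewrite -EFinM lee_fin le_eqVlt; apply/orP; left; apply/eqP.
  rewrite mulrA /gauss_fun; congr (_ * expR _); last first.
    by rewrite exprMn k2 /u exprMn; field; rewrite gt_eqF.
  rewrite /normal_peak k2 /u.
  rewrite (_ : s ^+ 2 * pi *+ 2 = s ^+ 2 * (2 * pi)); last by rewrite -mulr_natr; ring.
  rewrite sqrtrM ?sqr_ge0 // sqrtr_sqr gtr0_norm //.
  by field; rewrite !gt_eqF // sqrtr_gt0 mulr_gt0 // pi_gt0.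
have mhalf : measurable (`[u, +oo[ : set R) by exact: measurable_itv.
pose N : set R := -%R @^-1` `[u, +oo[.
have mN : measurable N.
  by rewrite /N opp_preimage_itvbndy; exact: measurable_itv.
have NE : normal_prob 0 s N = normal_prob 0 s `[u, +oo[.
  rewrite /normal_prob.
  transitivity (\int[pushforward mu (-%R : _ -> measurableTypeR R)]_(x in `[u, +oo[)
      (normal_pdf 0 s x)%:E)%E.
    rewrite ge0_integral_pushforward //=.
    - by apply: eq_integral => x _; rewrite !pdfE /gauss_fun mulrN sqrrN.
    - apply/measurable_EFinP/measurable_funTS; exact: measurable_normal_pdf.
    - by move=> x _; rewrite lee_fin normal_pdf_ge0.
  by apply: eq_measure_integral => A mA _; exact: lebesgue_measureN.
apply: (@le_trans _ _ (normal_prob 0 s (`[u, +oo[ `|` N)%classic)).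
  apply: le_measure; rewrite ?inE.
  - rewrite (_ : [set x | _] = [set x : R | u < `|x|]) //.
    rewrite (_ : [set x | _] = `]u, +oo[ `|` -%R @^-1` `]u, +oo[); last first.
      apply/seteqP; split => x /=; rewrite !in_itv /= !andbT ltr_normr.
        by case/orP; [left|right].
      by case=> ->; rewrite ?orbT.
    apply: measurableU; first exact: measurable_itv.
    by rewrite opp_preimage_itvbndy; exact: measurable_itv.
  - exact: measurableU.
  - move=> x; rewrite /= ltr_normr => /orP[] /ltW ux.
      by left; rewrite /= in_itv /= andbT.
    by right; rewrite /N /= in_itv /= andbT.
have : (normal_prob 0 s (`[u, +oo[ `|` N)%classic <=
    normal_prob 0 s `[u, +oo[ + normal_prob 0 s N)%E by exact: measureU2.
move/le_trans; apply.
by rewrite NE mulr_natl mulr2n EFinD; apply: leeD.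
Qed.
End gaussian_tail.

Lemma measurable_gt_normr (R : realType) (d : measure_display)
    (T : measurableType d) (f : T -> R) (c : R) :
  measurable_fun setT f -> measurable [set w | c < `|f w|].
Proof.
move=> mf.
rewrite (_ : [set w | _] = f @^-1` ((fun x : R => `|x|) @^-1` `]c, +oo[)).
  rewrite -[X in measurable X]setTI; apply: mf => //.
  rewrite -[X in measurable X]setTI.
  by apply: normr_measurable => //; exact: measurable_itv.
by apply/seteqP; split => w /=; rewrite in_itv /= andbT.
Qed.

Lemma lincomb_tail (R : realType) (d : measure_display) (T : measurableType d)
    (P : probability T R) (I : finType) (xi : I -> {RV P >-> R}) (sigma : R)
    (c : I -> R) (z : R) :
  mutually_independent xi -> 0 < sigma ->
  (forall i (A : set R), measurable A ->
     distribution P (xi i) A = normal_prob 0 sigma A) -> 0 < z ->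
  (P [set w | (z * (sigma * Num.sqrt (\sum_i c i ^+ 2))
                 < `|\sum_i c i * xi i w|)%R] <=
   (2 * ((z * Num.sqrt (2 * pi))^-1 * expR (- (z ^+ 2 / 2))))%:E)%E.
Proof.
move=> xi_indep s0 xi_law z0.
have [i0 ci0|c0] := pickP (fun i => c i != 0); last first.
  rewrite (_ : [set w | _] = set0).
    by rewrite measure0 lee_fin !mulr_ge0 ?expR_ge0 ?invr_ge0 ?mulr_ge0 ?sqrtr_ge0 // ltW.
  apply/seteqP; split => // w /=.
  have cE i : c i = 0 by apply/eqP/negbFE/c0.
  rewrite big1 ?sqrtr0 ?mulr0; last by move=> i _; rewrite cE expr0n.
  by rewrite big1 ?normr0 ?ltxx // => i _; rewrite cE mul0r.
pose c' i := c i / c i0.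
have n0 : 0 < `|c i0| by rewrite normr_gt0.
pose tau := sigma * Num.sqrt (\sum_i c' i ^+ 2).
have tauE : sigma * Num.sqrt (\sum_i c i ^+ 2) = tau * `|c i0|.
  rewrite /tau -mulrA -(sqrtr_sqr (c i0)) -sqrtrM; last first.
    by rewrite sumr_ge0 // => i _; exact: sqr_ge0.
  rewrite mulr_suml; congr (_ * Num.sqrt _); apply: eq_bigr => i _.
  by rewrite -exprMn /c' divfK.
have sumE w : \sum_i c i * xi i w = (\sum_i c' i * xi i w) * c i0.
  rewrite mulr_suml; apply: eq_bigr => i _.
  by rewrite mulrAC /c' divfK.
have tau0 : 0 < tau.
  rewrite mulr_gt0 // sqrtr_gt0 (bigD1 i0) //= /c' divff // expr1n.
  by rewrite ltr_pwDl // sumr_ge0 // => i _; exact: sqr_ge0.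
rewrite (_ : [set w | _] = [set w | [set x : R | z * tau < `|x|]
    (\sum_i c' i * xi i w)]); last first.
  by apply/funext => w; rewrite /= sumE tauE normrM mulrA ltr_pM2r.
rewrite (lincomb_normal xi xi_indep sigma s0 xi_law c' i0) ?/c' ?divff //.
  exact: normal_prob_tail.
exact: measurable_gt_normr.
Qed.

Lemma measure_exists_le (R : realType) (d : measure_display)
    (T : measurableType d) (P : probability T R) (J : finType)
    (F : J -> set T) (e : R) :
  (forall j, measurable (F j)) -> (forall j, (P (F j) <= e%:E)%E) ->
  measurable [set w | exists j, F j w] /\
  (P [set w | exists j, F j w] <= (#|J|%:R * e)%:E)%E.
Proof.
move=> mF PF.
have -> : [set w | exists j, F j w] = \big[setU/set0]_(j : J) F j.
  apply/seteqP; split => [w [j Fj]|w]; first by rewrite (bigD1 j) //=; left.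
  by elim/big_ind : _ => [[]|A B HA HB [/HA|/HB]|j _ Fj] //; exists j.
have [mU PU] : measurable (\big[setU/set0]_(j : J) F j) /\
    (P (\big[setU/set0]_(j : J) F j) <= \sum_(j : J) e%:E)%E.
  apply: (@big_ind2 _ _ (fun (A : set T) (x : \bar R) =>
    measurable A /\ (P A <= x)%E)) => //.
  - by rewrite measure0.
  - move=> A x B y [mA PA] [mB PB]; split; first exact: measurableU.
    have : (P (A `|` B) <= P A + P B)%E by exact: measureU2.
    by move/le_trans; apply; exact: leeD.
split => //; apply: le_trans PU _.
by rewrite sumEFin lee_fin sumr_const mulr_natl.
Qed.

Lemma gaussian_union_bound (R : realType) (p : nat) (b z : R) : (2 <= p)%N ->
  1 <= b -> z = b * Num.sqrt (2 * ln p%:R) ->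
  p%:R * (2 * ((z * Num.sqrt (2 * pi))^-1 * expR (- (z ^+ 2 / 2)))) <=
  (p%:R `^ (b ^+ 2 - 1) * Num.sqrt (pi * ln p%:R))^-1.
Proof.
move=> p2 b1 zE.
have p1 : 1 < p%:R :> R by rewrite ltr1n.
have p0 : 0 < p%:R :> R by apply: lt_trans p1.
have l0 : 0 < ln p%:R :> R by exact: ln_gt0.
have b0 : 0 < b by apply: lt_le_trans b1.
have z2 : z ^+ 2 / 2 = b ^+ 2 * ln p%:R.
  by rewrite zE exprMn sqr_sqrtr ?mulr_ge0 ?ltW //; field.
have -> : z * Num.sqrt (2 * pi) = 2 * b * Num.sqrt (pi * ln p%:R).
  rewrite zE -mulrA -sqrtrM ?mulr_ge0 ?ltW //.
  rewrite (_ : 2 * ln p%:R * (2 * pi) = 2 ^+ 2 * (pi * ln p%:R)); last by ring.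
  by rewrite sqrtrM ?sqr_ge0 // sqrtr_sqr ger0_norm // mulrA [b * 2]mulrC.
rewrite z2 /powR gt_eqF // mulrBl mul1r expRD !expRN lnK ?posrE //.
have s0 : 0 < Num.sqrt (pi * ln p%:R : R).
  by rewrite sqrtr_gt0 mulr_gt0 // pi_gt0.
set e := expR _; have e0 : 0 < e := expR_gt0 _.
set q := Num.sqrt _ in s0 *.
rewrite (_ : _ * (2 * _) = b^-1 * (e / p%:R * q)^-1); last first.
  by field; rewrite !gt_eqF.
rewrite ler_piMl ?invf_le1 // invr_ge0 !mulr_ge0 ?invr_ge0 // ltW //.
Qed.

Theorem corollary4 (R : realType) (d : measure_display) (T : measurableType d)
    (P : probability T R) (n p : nat) (hp : (2 <= p)%N) (hn : (1 <= n)%N)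
    (x : 'I_n -> 'cV[R]_p) (betastar : 'cV[R]_p)
    (sigma : R) (hsigma : 0 < sigma)
    (xi : 'I_n -> {RV P >-> R})
    (hxi_law : forall (i : 'I_n) (A : set R), measurable A ->
       distribution P (xi i) A = normal_prob 0 sigma A)
    (hxi_indep : mutually_independent xi)
    (Y : 'I_n -> T -> R)
    (hY : forall (i : 'I_n) (w : T),
       Y i w = ((x i)^T *m betastar) 0 0 + xi i w)
    (hdiag : forall j : 'I_p,
       (n%:R^-1 *: ((design x)^T *m design x)) j j <= 1)
    (b : R) (hb : 1 <= b)
    (C : R) (hC : C = 3 * b * Num.sqrt 2)
    (lambda : R) (hlambda : lambda = C * sigma * Num.sqrt (ln p%:R / n%:R))
    (betahat : T -> 'cV[R]_p)
    (hbetahat : forall w : T, is_lasso x (fun i => Y i w) lambda (betahat w))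
    (s : nat) (hs1 : (1 <= s)%N) (hsp : (s <= p)%N)
    (hRE : RE (design x) s 5) :
  with_probability_at_least P
    (1 - (p%:R `^ (b ^+ 2 - 1) * Num.sqrt (pi * ln p%:R))^-1)
    [set w : T |
      n%:R^-1 * norm2 (design x *m (betahat w - betastar)) ^+ 2 <=
      inf [set n%:R^-1 * norm2 (design x *m (beta - betastar)) ^+ 2
               + C ^+ 2 * sigma ^+ 2 / kappa (design x) s 5 ^+ 2
                 * ((nnz beta)%:R * ln p%:R / n%:R)
          | beta in [set beta : 'cV[R]_p | (nnz beta <= s)%N]]].
Proof.
set X := design x; set k := kappa _ _ _; set oracle := inf _.
have n0 : 0 < n%:R :> R by rewrite ltr0n.
have l0 : 0 < ln p%:R :> R by rewrite ln_gt0 // ltr1n.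
have b0 : 0 < b by apply: lt_le_trans hb.
have C0 : 0 < C by rewrite hC !mulr_gt0 // sqrtr_gt0.
have lambda0 : 0 < lambda.
  by rewrite hlambda !mulr_gt0 // sqrtr_gt0 divr_gt0.
have mY i : measurable_fun setT (Y i).
  rewrite (_ : Y i = fun w => ((x i)^T *m betastar) 0 0 + xi i w).
    exact: measurable_funD.
  by apply/funext => w; exact: hY.
pose noise j w := \sum_i n%:R^-1 * x i j 0 * xi i w.
have mnoise j : measurable_fun setT (noise j).
  by apply: measurable_sum => i; exact: measurable_funM.
pose z := b * Num.sqrt (2 * ln p%:R).
have z0 : 0 < z by rewrite mulr_gt0 // sqrtr_gt0 mulr_gt0.
have lambdaE : lambda / 3 = z * (sigma * Num.sqrt n%:R^-1).
  by rewrite hlambda hC /z !sqrtrM ?ltW //; field.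
have col_le j : Num.sqrt (\sum_i (n%:R^-1 * x i j 0) ^+ 2) <= Num.sqrt n%:R^-1.
  have in0 : 0 < n%:R^-1 :> R by rewrite invr_gt0.
  rewrite ler_sqrt //.
  have := hdiag j; rewrite !mxE => H.
  under eq_bigr do rewrite exprMn expr2 -mulrA.
  rewrite -mulr_sumr -[X in _ <= X]mulr1 ler_pM2l //.
  apply: le_trans H; rewrite mulr_sumr le_eqVlt; apply/orP; left; apply/eqP.
  by apply: eq_bigr => i _; rewrite !mxE expr2.
pose bad j := [set w | lambda / 3 < `|noise j w|].
have mbad j : measurable (bad j) by exact: measurable_gt_normr.
set eta := 2 * ((z * Num.sqrt (2 * pi))^-1 * expR (- (z ^+ 2 / 2))).
have Pbad j : (P (bad j) <= eta%:E)%E.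
  pose c i := n%:R^-1 * x i j 0.
  apply: le_trans (lincomb_tail _ _ _ _ _ _ sigma c z hxi_indep hsigma hxi_law z0).
  apply: le_measure; rewrite ?inE //.
    exact: (measurable_gt_normr _ _ _ (noise j)).
  move=> w; apply: le_lt_trans; rewrite lambdaE.
  by rewrite ler_pM2l // ler_pM2l //; exact: col_le.
have [mU PU] := measure_exists_le _ _ _ P _ bad eta mbad Pbad.
set U := [set w | _] in mU PU.
set E := [set w | _].
have mE : measurable E.
  have mfit : measurable_fun setT
      (fun w => n%:R^-1 * norm2 (X *m (betahat w - betastar)) ^+ 2).
    rewrite (_ : (fun w => _) = fun w => n%:R^-1 *
        \sum_i ((X *m betahat w) i 0 - (X *m betastar) i 0) ^+ 2).
      apply: measurable_funM => //; apply: measurable_sum => i.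
      apply: measurable_funX; apply: measurable_funB => //.
      exact: (measurable_lasso_fit _ _ _ _ _ _ _ _ _ i hn (ltW lambda0) mY hbetahat).
    apply/funext => w; rewrite norm2_sq; congr (_ * _).
    by apply: eq_bigr => i _; rewrite mulmxBr !mxE.
  rewrite (_ : E = (fun w => n%:R^-1 * norm2 (X *m (betahat w - betastar)) ^+ 2)
      @^-1` `]-oo, oracle]).
    by rewrite -[X in measurable X]setTI; apply: mfit => //; exact: measurable_itv.
  by apply/seteqP; split => w /=; rewrite in_itv.
have UE : ~` U `<=` E.
  move=> w nU; rewrite /E /=; apply: lb_le_inf.
    by exists (n%:R^-1 * norm2 (X *m (0 - betastar)) ^+ 2 +
        C ^+ 2 * sigma ^+ 2 / k ^+ 2 * ((nnz (0 : 'cV[R]_p))%:R * ln p%:R / n%:R)),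
      0 => //; rewrite /= /nnz eq_card0 // => i; rewrite !inE mxE eqxx.
  move=> _ [beta /= beta_s <-].
  rewrite (_ : C ^+ 2 * _ / _ * _ = lambda ^+ 2 / k ^+ 2 * (nnz beta)%:R).
    apply: (sharp_oracle _ _ _ _ _ _ _ (fun i => Y i w) (fun i => xi i w)) => //.
    - exact: ltW.
    - by move=> i; rewrite hY designE.
    - move=> j; rewrite leNgt; apply/negP => bad_j; apply: nU; by exists j.
  rewrite hlambda [in RHS]exprMn sqr_sqrtr ?divr_ge0 ?ltW // exprMn.
  by ring.
split=> //; apply: (@le_trans _ _ (P (~` U))); last first.
  by apply: le_measure; rewrite ?inE //; exact: measurableC.
rewrite probability_setC // EFinB; apply: leeB => //.
apply: le_trans PU _; rewrite lee_fin card_ord.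
exact: gaussian_union_bound.
Qed.
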